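(* Let $k$ be a field, $G$ a finite group, $x\in G$ a representative of a conjugacy class, and $n\ge1$. Let $\bigtriangleup_x:H^n(\mathcal{H}_x^* )\to H^{n-1}(\mathcal{H}_x^* )$ be the map induced by the restriction of the Batalin–Vilkovisky operator $\bigtriangleup$ to the subcomplex $\mathcal{H}_x^*$, and let $\widehat{\bigtriangleup}_x:H^n(C_G(x),k)\to H^{n-1}(C_G(x),k)$ be the map corresponding to $\bigtriangleup_x$ under the isomorphisms $H^*(\mathcal{H}_x^* )\simeq H^*(C_G(x),k)$ which send the class of a cocycle $\varphi\in\mathcal{H}_x^n$ to the class of $\psi:\overline{C_G(x)}^{\times n}\to k$, with $\psi(h_1,\dots,h_n)$ the coefficient of $x$ in $\varphi(h_1,\dots,h_n)h_n^{-1}\cdots h_1^{-1}\in kC_x$. Then $\widehat{\bigtriangleup}_x$ is given by $$\widehat{\bigtriangleup}_x(\psi)(h_1,\dots,h_{n-1})=\sum_{i=1}^n(-1)^{i(n-1)}\psi(h_i,\dots,h_{n-1},\,h_{n-1}^{-1}\cdots h_1^{-1}x^{-1},\,h_1,\dots,h_{i-1})$$ for $\psi:\overline{C_G(x)}^{\times n}\to k$ (a cocycle representing a class in $H^n(C_G(x),k)$) and $h_1,\dots,h_{n-1}\in\overline{C_G(x)}$.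
   Context: For a group $H$ write $\overline{H}=H\setminus\{1\}$. For a $k$-vector space $V$, $\mathrm{Map}(\overline{H}^{\times n},V)$ denotes all maps of sets, identified with $\mathrm{Hom}_k((kH/k\cdot 1)^{\otimes n},V)$ (and with $V$ for $n=0$); accordingly, in every formula such a map takes the value $0$ whenever one of its arguments equals $1$. Hochschild cohomology: $HH^*(kG)$ is the cohomology of $\mathcal{H}^n=\mathrm{Map}(\overline{G}^{\times n},kG)$ with differential $\delta_0(a)(g)=ga-ag$ and $$\delta_n(\varphi)(g_1,\dots,g_{n+1})=g_1\varphi(g_2,\dots,g_{n+1})+\sum_{i=1}^n(-1)^i\varphi(g_1,\dots,g_ig_{i+1},\dots,g_{n+1})+(-1)^{n+1}\varphi(g_1,\dots,g_n)g_{n+1}.$$ Group cohomology: for a finite group $H$, $H^*(H,k)$ (trivial coefficients) is the cohomology of $\mathrm{Map}(\overline{H}^{\times n},k)$ with $$\delta_n(\psi)(h_1,\dots,h_{n+1})=\psi(h_2,\dots,h_{n+1})+\sum_{i=1}^n(-1)^i\psi(h_1,\dots,h_ih_{i+1},\dots,h_{n+1})+(-1)^{n+1}\psi(h_1,\dots,h_n).$$ $C_x$ is the conjugacy class of $x$ and $C_G(x)$ its centralizer. $\mathcal{H}_x^0=kC_x$ and, for $n\ge1$, $\mathcal{H}_x^n$ is the space of maps $\varphi:\overline{G}^{\times n}\to kG$ such that $\varphi(g_1,\dots,g_n)$ lies in the $k$-span of the set $g_1\cdots g_nC_x$ for all $g_1,\dots,g_n\in\overline{G}$; $\mathcal{H}_x^*$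 is a subcomplex (indeed a direct summand) of $\mathcal{H}^*$, and the map $H^*(\mathcal{H}_x^* )\to H^*(C_G(x),k)$ described in the claim is an isomorphism. Let $\langle\ ,\ \rangle:kG\times kG\to k$ be the bilinear form with $\langle g,h\rangle=1$ if $g=h^{-1}$ and $0$ otherwise ($g,h\in G$). For $n\ge1$ the Batalin–Vilkovisky operator $\bigtriangleup:\mathcal{H}^n\to\mathcal{H}^{n-1}$ is $$\bigtriangleup(\varphi)(g_1,\dots,g_{n-1})=\sum_{g_n\in G}\sum_{i=1}^n(-1)^{i(n-1)}\langle\varphi(g_i,\dots,g_{n-1},g_n,g_1,\dots,g_{i-1}),1\rangle\,g_n^{-1}.$$ It induces an operator $HH^n(kG)\to HH^{n-1}(kG)$, and it maps $\mathcal{H}_x^n$ into $\mathcal{H}_x^{n-1}$. *)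

(* Defs.v *)
From HB Require Import structures.
From mathcomp Require Import all_boot all_order all_algebra all_fingroup.
From mathcomp Require Import generic_quotient ring_quotient.
From mathcomp Require Import boolp classical_sets functions.

Set Implicit Arguments.
Unset Strict Implicit.
Unset Printing Implicit Defensive.

Import GRing.Theory.
Local Open Scope ring_scope.

Section Cohomology.

(* Cohomology of the subspaces S n of a sequence of spaces V n with linear maps
   d n : V n -> V n.+1. *)
Variables (k : fieldType) (V : nat -> vectType k).
Variables (d : forall n, 'Hom(V n, V n.+1)) (S : forall n, {vspace V n}).

Definition cocycles n : {vspace V n} := (S n :&: lker (d n))%VS.

Definition coboundaries n : {vspace V n} :=
  match n with 0 => 0%VS | m.+1 => (d m @: S m)%VS end.

Definition cobounding (n : nat) : {pred subvs_of (cocycles n)} :=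
  [pred z | vsval z \in coboundaries n].
Arguments cobounding : clear implicits.

Lemma cobounding_zmod_closed n : zmod_closed (cobounding n).
Proof.
split=> [|u v]; rewrite !inE ?linear0 ?mem0v //.
by move=> hu hv; rewrite linearB rpredB.
Qed.

HB.instance Definition _ n :=
  GRing.isZmodClosed.Build (subvs_of (cocycles n)) (cobounding n) (@cobounding_zmod_closed n).

(* H^n = Z^n / B^n, a quotient type; the structure of k-vector space follows. *)
Definition cohomology n := Quotient.quot (cobounding n).

HB.instance Definition _ n := GRing.Zmodule.on (cohomology n).

Definition coh_proj n (z : subvs_of (cocycles n)) : cohomology n :=
  (\pi_(Quotient.quot (cobounding n)) z)%qT.

Lemma coh_projP n (z z' : subvs_of (cocycles n)) :
  reflect (coh_proj z = coh_proj z') (vsval z - vsval z' \in coboundaries n).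
Proof.
have -> : (vsval z - vsval z' \in coboundaries n) = (z - z' \in cobounding n).
  by rewrite inE linearB.
by rewrite Quotient.idealrBE; apply: eqP.
Qed.

Lemma coh_proj_repr n (c : cohomology n) : coh_proj (repr c) = c.
Proof. exact: reprK. Qed.

Lemma coh_projD n : {morph @coh_proj n : u v / u + v}.
Proof. exact: pi_addr. Qed.

Definition coh_scale n (a : k) (c : cohomology n) : cohomology n :=
  coh_proj (a *: repr c).

Lemma coh_scale_proj n a (z : subvs_of (cocycles n)) :
  coh_scale a (coh_proj z) = coh_proj (a *: z).
Proof.
apply/coh_projP; rewrite -linearB -scalerBr linearZ rpredZ // linearB.
by apply/coh_projP; rewrite coh_proj_repr.
Qed.

Fact coh_scaleA n a b (c : cohomology n) :
  coh_scale a (coh_scale b c) = coh_scale (a * b) c.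
Proof. by rewrite -(coh_proj_repr c) !coh_scale_proj scalerA. Qed.

Fact coh_scale1 n : left_id 1 (@coh_scale n).
Proof. by move=> c; rewrite -(coh_proj_repr c) coh_scale_proj scale1r. Qed.

Fact coh_scaleDr n : right_distributive (@coh_scale n) +%R.
Proof.
move=> a u v; rewrite -(coh_proj_repr u) -(coh_proj_repr v).
by rewrite -coh_projD !coh_scale_proj scalerDr coh_projD.
Qed.

Fact coh_scaleDl n (c : cohomology n) :
  {morph (@coh_scale n)^~ c : a b / a + b}.
Proof.
by move=> a b; rewrite -(coh_proj_repr c) !coh_scale_proj scalerDl coh_projD.
Qed.

HB.instance Definition _ n :=
  GRing.Zmodule_isLmodule.Build k (cohomology n)
    (@coh_scaleA n) (@coh_scale1 n) (@coh_scaleDr n) (@coh_scaleDl n).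

(* The class of a cochain; only meaningful on cocycles. *)
Definition coh_class n (v : V n) : cohomology n :=
  coh_proj (vsproj (cocycles n) v).

Lemma coh_classP n (v v' : V n) : v \in cocycles n -> v' \in cocycles n ->
  reflect (coh_class v = coh_class v') (v - v' \in coboundaries n).
Proof.
move=> hv hv'.
by have := @coh_projP n (vsproj _ v) (vsproj _ v'); rewrite !vsprojK.
Qed.

(* A cocycle representing a given class. *)
Definition coh_rep n (c : cohomology n) : V n := vsval (repr c).

Lemma coh_repP n (c : cohomology n) : coh_rep c \in cocycles n.
Proof. exact: subvsP. Qed.

Lemma coh_repK n : cancel (@coh_rep n) (@coh_class n).
Proof. by move=> c; rewrite /coh_class vsvalK coh_proj_repr. Qed.

End Cohomology.

Section InducedMaps.

Variable k : fieldType.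
Variables (V : nat -> vectType k) (d : forall n, 'Hom(V n, V n.+1)).
Variables (S : forall n, {vspace V n}).
Variables (W : nat -> vectType k) (e : forall n, 'Hom(W n, W n.+1)).
Variables (T : forall n, {vspace W n}).
Variables (n m : nat).

(* The map sending the class of v to the class of f v. *)
Definition coh_map (f : V n -> W m) (c : cohomology d S n) :
  cohomology e T m := coh_class e T (f (coh_rep c)).

Lemma coh_mapE (f : {additive V n -> W m}) :
    {in cocycles d S n, forall v, f v \in cocycles e T m} ->
    {in coboundaries d S n, forall v, f v \in coboundaries e T m} ->
  {in cocycles d S n, forall v, coh_map f (coh_class d S v) = coh_class e T (f v)}.
Proof.
move=> fZ fB v Zv; apply/coh_classP; rewrite ?fZ ?coh_repP //.
rewrite -raddfB fB //; apply/(coh_classP (d := d) (S := S)) => //.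
  exact: coh_repP.
exact: coh_repK.
Qed.

End InducedMaps.

Arguments coh_map {k V} d S {W} e T {n m} f c.

Section Cochains.

Variables (k : fieldType) (H : finGroupType).

Definition nontriv : finType := {h : H | h != 1%g}.

Definition cochain (V : vectType k) (n : nat) : vectType k :=
  {ffun n.-tuple nontriv -> V}.

(* phi (h_1, ..., h_n) for arbitrary h_i in H: 0 as soon as some h_i is 1.
   [pmap insub s] drops the entries of s equal to 1, so that its size is n
   iff there are none of them. *)
Definition cochain_eval (V : vectType k) n (phi : cochain V n) (s : seq H) : V :=
  if size s == n then oapp phi 0 (insub (pmap insub s)) else 0.

Lemma cochain_evalE (V : vectType k) n (phi : cochain V n) (t : n.-tuple nontriv) :
  cochain_eval phi (map val t) = phi t.
Proof.
rewrite /cochain_eval size_map size_tuple eqxx.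
have -> : pmap insub (map val t) = t :> seq nontriv.
  by rewrite map_pK //; apply: valK.
by rewrite valK.
Qed.

Lemma cochain_eval_eq0 (V : vectType k) n (phi : cochain V n) (s : seq H) :
  1%g \in s -> cochain_eval phi s = 0.
Proof.
move=> s1; rewrite /cochain_eval; case: eqP => // sn.
rewrite insubN // -sn size_pmap_sub -all_count.
by apply/allPn; exists 1%g; rewrite // eqxx.
Qed.

(* (h_1, ..., h_i h_(i+1), ..., h_m), where i counts from 0 *)
Definition mul_at (i : nat) (s : seq H) : seq H :=
  take i s ++ (nth 1 s i * nth 1 s i.+1)%g :: drop i.+2 s.

(* The bar differential with coefficients in V, where H acts on the left by l
   and on the right by r. *)
Definition bar_diff (V : vectType k) (l r : H -> V -> V) n
    (phi : cochain V n) : cochain V n.+1 :=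
  [ffun t : n.+1.-tuple nontriv => let s := map val t in
     l (head 1%g s) (cochain_eval phi (behead s))
     + \sum_(i < n) (-1) ^+ i.+1 *: cochain_eval phi (mul_at i s)
     + (-1) ^+ n.+1 *: r (last 1%g s) (cochain_eval phi (take n s))].

Lemma cochain_eval_is_linear (V : vectType k) n (s : seq H) :
  linear (fun phi : cochain V n => cochain_eval phi s).
Proof.
move=> a u v; rewrite /cochain_eval; case: eqP => _; last by rewrite scaler0 addr0.
by case: insub => [t|] /=; rewrite ?ffunE ?scaler0 ?addr0.
Qed.

Lemma bar_diff_is_linear (V : vectType k) (l r : H -> {linear V -> V}) n :
  linear (@bar_diff V l r n).
Proof.
move=> a u v; apply/ffunP => t; rewrite !ffunE /=.
have scaleP c (y z : V) : c *: (a *: y + z) = a *: (c *: y) + c *: z.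
  by rewrite scalerDr !scalerA mulrC.
rewrite !cochain_eval_is_linear [l _ _]linearP [r _ _]linearP scaleP.
under eq_bigr => i _ do rewrite cochain_eval_is_linear scaleP.
rewrite big_split /= -scaler_sumr !scalerDr.
by rewrite (addrACA (a *: l _ _)) (addrACA (_ + _)).
Qed.

HB.instance Definition _ (V : vectType k) (l r : H -> {linear V -> V}) n :=
  GRing.isLinear.Build k (cochain V n) (cochain V n.+1) _ (@bar_diff V l r n)
    (@bar_diff_is_linear V l r n).

Definition group_diff n : 'Hom(cochain k^o n, cochain k^o n.+1) :=
  linfun (@bar_diff k^o (fun=> idfun) (fun=> idfun) n).

(* H^n(H, k), with trivial coefficients *)
Definition group_cohomology : nat -> lmodType k :=
  cohomology group_diff (fun=> fullv).

Definition group_cocycles : forall n, {vspace cochain k^o n} :=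
  cocycles group_diff (fun=> fullv).

Definition group_class n : cochain k^o n -> group_cohomology n :=
  @coh_class _ _ group_diff (fun=> fullv) n.

End Cochains.

Section Hochschild.

Variables (k : fieldType) (G : finGroupType).

(* kG, an element being identified with the family of its coefficients *)
Definition group_alg : vectType k := {ffun G -> k^o}.

Definition gelt (g : G) : group_alg := [ffun h => (h == g)%:R].

Definition gmul (a b : group_alg) : group_alg :=
  [ffun h => \sum_(g : G) a g * b (g^-1 * h)%g].

Definition gmulr (b a : group_alg) : group_alg := gmul a b.

Lemma gmul_is_linear (a : group_alg) : linear (gmul a).
Proof.
move=> c u v; apply/ffunP => h; rewrite !ffunE scaler_sumr -big_split /=.
by apply: eq_bigr => g _; rewrite !ffunE mulrDr /GRing.scale /= mulrCA.
Qed.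

Lemma gmulr_is_linear (b : group_alg) : linear (gmulr b).
Proof.
move=> c u v; apply/ffunP => h; rewrite !ffunE scaler_sumr -big_split /=.
by apply: eq_bigr => g _; rewrite !ffunE mulrDl /GRing.scale /= mulrA.
Qed.

HB.instance Definition _ a :=
  GRing.isLinear.Build k group_alg group_alg _ (gmul a) (gmul_is_linear a).
HB.instance Definition _ b :=
  GRing.isLinear.Build k group_alg group_alg _ (gmulr b) (gmulr_is_linear b).

Definition gform (a b : group_alg) : k :=
  \sum_(g : G) \sum_(h : G) a g * b h * (g == h^-1)%g%:R.

Definition hoch_diff n : 'Hom(cochain G group_alg n, cochain G group_alg n.+1) :=
  linfun (@bar_diff k G group_alg (fun g => gmul (gelt g))
                                  (fun g => gmulr (gelt g)) n).

(* In degree n.+1; i counts from 0. *)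
Definition BV n (phi : cochain G group_alg n.+1) : cochain G group_alg n :=
  [ffun t : n.-tuple (nontriv G) => let s := map val t in
     \sum_(g : G) \sum_(i < n.+1)
       ((-1) ^+ (i.+1 * n)
        * gform (cochain_eval phi (drop i s ++ g :: take i s)) (gelt 1%g))
       *: gelt g^-1%g].

Definition cochain_at n (t : n.-tuple (nontriv G))
  (phi : cochain G group_alg n) : group_alg := phi t.

Lemma cochain_at_is_linear n t : linear (@cochain_at n t).
Proof. by move=> a u v; rewrite /cochain_at !ffunE. Qed.

HB.instance Definition _ n t :=
  GRing.isLinear.Build k (cochain G group_alg n) group_alg _ (@cochain_at n t)
    (@cochain_at_is_linear n t).

(* the span of the set g C_x *)
Definition coset_span (x g : G) : {vspace group_alg} :=
  <<[seq gelt (g * c)%g | c in (x ^: [set: G])%g]>>%VS.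

(* The subspace of the phi with phi (g_1, ..., g_n) in the span of
   g_1 ... g_n C_x; see memHx. *)
Definition Hx (x : G) n : {vspace cochain G group_alg n} :=
  (\bigcap_(t : n.-tuple (nontriv G))
     linfun (cochain_at t) @^-1: coset_span x (\prod_(g <- t) val g)%g)%VS.

Lemma memHx x n (phi : cochain G group_alg n) :
  reflect (forall t, phi t \in coset_span x (\prod_(g <- t) val g)%g)
          (phi \in Hx x n).
Proof.
rewrite memvE; apply: (iffP subv_bigcapP) => h t.
  by have := h t isT; rewrite -memvE -memv_preim lfunE.
by move=> _; rewrite -memvE -memv_preim lfunE; apply: h.
Qed.

Definition Hx_cohomology (x : G) : nat -> lmodType k :=
  cohomology hoch_diff (Hx x).

Definition BVx (x : G) n : Hx_cohomology x n.+1 -> Hx_cohomology x n :=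
  coh_map (V := cochain G group_alg) hoch_diff (Hx x) hoch_diff (Hx x)
    (@BV n).

(* C_G(x), as a group in its own right *)
Definition centr (x : G) : finGroupType := subg_of 'C[x]%G.

(* psi (h_1, ..., h_n) is the coefficient of x in
   phi (h_1, ..., h_n) h_n^-1 ... h_1^-1. *)
Definition centr_res (x : G) n (phi : cochain G group_alg n) :
    cochain (centr x) k^o n :=
  [ffun t : n.-tuple (nontriv (centr x)) =>
     let s := [seq sgval (val h) | h <- t] in
     gmul (cochain_eval phi s) (gelt (\prod_(h <- rev s) h^-1)%g) x].

Definition centr_iso (x : G) n :
    Hx_cohomology x n -> group_cohomology k (centr x) n :=
  coh_map (V := cochain G group_alg) hoch_diff (Hx x)
    (@group_diff k (centr x)) (fun=> fullv) (@centr_res x n).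

(* centr_iso is bijective, hence pinv is its inverse. *)
Definition BVhat (x : G) n :
    group_cohomology k (centr x) n.+1 -> group_cohomology k (centr x) n :=
  @centr_iso x n \o @BVx x n \o 'pinv_(fun=> 0) setT%classic (@centr_iso x n.+1).

Definition BVhat_formula (x : G) n (psi : cochain (centr x) k^o n.+1) :
    cochain (centr x) k^o n :=
  (* x itself, as an element of its centralizer *)
  let xC : centr x := subg 'C[x]%G x in
  [ffun t : n.-tuple (nontriv (centr x)) => let s := map val t in
     \sum_(i < n.+1) (-1) ^+ (i.+1 * n)
       * cochain_eval psi
           (drop i s ++ ((\prod_(h <- rev s) h^-1) * xC^-1)%g :: take i s)].

End Hochschild.

(* Main.v *)
(* Restriction to the centralizer intertwines the Batalin-Vilkovisky operator with
   its formula already on cochains: taking the coefficient of x in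
   (BV phi)(h_1, ..., h_n) h_n^-1 ... h_1^-1 forces the summation variable g to be
   h_n^-1 ... h_1^-1 x^-1, and then all the cyclic words in the h_i and g have
   product x^-1. The operator is the cyclic B of the bar construction, so it
   anticommutes with the differential. A Shapiro-type section of the restriction,
   obtained from chosen conjugators of the elements of C_x to x, is a chain map; it
   makes the map on cohomology surjective and transports B d = - d B to the formula.
   Injectivity plays no role, as the formula respects coboundaries. *)
From HB Require Import structures.
Require Import Defs.
From mathcomp Require Import all_boot all_order all_algebra all_fingroup.
From mathcomp Require classical_sets functions.
From mathcomp Require Import zify.

Set Implicit Arguments.
Unset Strict Implicit.
Unset Printing Implicit Defensive.

Import GRing.Theory.
Local Open Scope ring_scope.

Lemma eq_sign (R : pzRingType) (a b : nat) :
  odd a = odd b -> (-1) ^+ a = (-1) ^+ b :> R.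
Proof. by move=> ab; rewrite -signr_odd ab signr_odd. Qed.

(** * Signed sums over the rotations of a word *)

Section CyclicSums.

Variables (R : comPzRingType) (T : Type).
Implicit Types (F : seq T -> R) (u : seq T).

(* BV phi is made of these sums, for u of size n.+1; the term of index i = n is
   F u itself, with sign (-1)^((n+1)n) = 1. *)
Definition cyclic_sum n F u : R :=
  \sum_(i < n.+1) (-1) ^+ (i.+1 * n) * F (rot i.+1 u).

Lemma eq_cyclic_sum n F F' u : (forall i, F (rot i u) = F' (rot i u)) ->
  cyclic_sum n F u = cyclic_sum n F' u.
Proof. by move=> FF'; apply: eq_bigr => i _; rewrite FF'. Qed.

(** The full rotation is the identity and [(n+1) n] is even, so the last term can serve as the term
    of index 0. *)
Lemma cyclic_sumE n F u : size u = n.+1 ->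
  cyclic_sum n F u = \sum_(i < n.+1) (-1) ^+ (i * n) * F (rot i u).
Proof.
move=> un; rewrite /cyclic_sum big_ord_recr big_ord_recl /= addrC.
congr (_ + _); rewrite rot0 (_ : rot n.+1 u = u); last by rewrite -un rot_size.
by congr (_ * _); apply: eq_sign; rewrite mul0n oddM /= andNb.
Qed.

Lemma cyclic_sum_rot1 n F u : size u = n.+1 ->
  cyclic_sum n F (rot 1 u) = (-1) ^+ n * cyclic_sum n F u.
Proof.
move=> un; rewrite cyclic_sumE ?size_rot // mulr_sumr.
apply: eq_bigr => i _; rewrite rot_rot -rotS ?un // mulrA -exprD.
by congr (_ * _); apply: eq_sign; rewrite oddD !oddM /=; case: odd; case: odd.
Qed.

Lemma cyclic_sum_rot n F j u : size u = n.+1 -> (j <= n.+1)%N ->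
  cyclic_sum n F (rot j u) = (-1) ^+ (j * n) * cyclic_sum n F u.
Proof.
move=> un; elim: j => [|j IH] jn; first by rewrite rot0 mul1r.
rewrite rotS ?un // cyclic_sum_rot1 ?size_rot // IH; last exact: ltnW.
by rewrite mulrA -exprD mulSn.
Qed.

Lemma cyclic_sum_rotr n F j u : size u = n.+1 -> (j <= n.+1)%N ->
  cyclic_sum n F (rotr j u) = (-1) ^+ (j * n) * cyclic_sum n F u.
Proof.
move=> un jn; rewrite -{2}(rotrK j u) cyclic_sum_rot ?size_rotr // mulrA.
by rewrite -exprD addnn (@eq_sign _ _ 0) ?mul1r // odd_double.
Qed.

(** Reversing the index, [j = n - i], turns the right rotation by [j] into the left rotation by
    [i + 1]; the signs agree because [n (n - 2i - 1)] is even. *)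
Lemma cyclic_sum_rotrE n F u : size u = n.+1 ->
  \sum_(j < n.+1) (-1) ^+ (j * n) * F (rotr j u) = cyclic_sum n F u.
Proof.
move=> un; rewrite (reindex_inj rev_ord_inj); apply: eq_bigr => i _ /=.
have in1 : (i <= n)%N by rewrite -ltnS.
rewrite /rotr un subSS (_ : n.+1 - (n - i) = i.+1)%N; last lia.
congr (_ * _); apply: eq_sign; rewrite !oddM oddB //=.
by case: odd; case: odd.
Qed.

Lemma cyclic_sum_comp_rot n F j u :
  cyclic_sum n (F \o rot j) u = cyclic_sum n F (rot j u).
Proof. by apply: eq_bigr => i _ /=; rewrite rot_rot. Qed.

Lemma cyclic_sum_comp_rotr n F j u :
  cyclic_sum n (F \o rotr j) u = cyclic_sum n F (rotr j u).
Proof. by apply: eq_bigr => i _ /=; rewrite rot_rotr. Qed.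

End CyclicSums.

(** * Cyclic sums and the faces of the bar construction *)

Section CyclicBar.

Variables (R : comPzRingType) (H : finGroupType).
Implicit Types (F P : seq H -> R) (s : seq H).

Lemma size_mul_at j s : (j.+1 < size s)%N -> size (mul_at j s) = (size s).-1.
Proof. by rewrite size_cat /= size_take size_drop; case: ifP; lia. Qed.

(** Through this every face reduces to the face at 0, at the price of rotations, which a cyclic sum
    turns into signs. *)
Lemma mul_at_rot j s : (j.+1 < size s)%N ->
  mul_at j s = rotr j (mul_at 0 (rot j s)).
Proof.
move=> js; have j_s := ltnW js.
rewrite /rot (drop_nth 1%g j_s) (drop_nth 1%g js) /mul_at /= drop0.
set w := (_ * _)%g; have := rotr_size_cat (w :: drop j.+2 s) (take j s).
by rewrite size_takel ?(ltnW j_s) // => ->.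
Qed.

(* The identity B b = - b B for the cyclic bar construction. *)
Lemma cyclic_sum_bar n F P s : size s = n.+2 ->
  cyclic_sum n.+1 (fun u => P u
      + \sum_(i < n.+1) (-1) ^+ i.+1 * F (mul_at i u)
      + (-1) ^+ n.+2 * P (rotr 1 u)) s
  = - (\sum_(j < n.+1) (-1) ^+ j * cyclic_sum n F (mul_at j s)
       + (-1) ^+ n.+1 * cyclic_sum n F (mul_at 0 (rotr 1 s))).
Proof.
move=> sn; have sizeM (u : seq H) : size u = n.+2 -> size (mul_at 0 u) = n.+1.
  by move=> un; rewrite size_mul_at un.
(* The [n + 2] cyclic faces of [s], the last of which multiplies the last entry by the first, are up
   to rotation the faces at 0 of the rotations of [s]. *)
have -> : \sum_(j < n.+1) (-1) ^+ j * cyclic_sum n F (mul_at j s)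
       + (-1) ^+ n.+1 * cyclic_sum n F (mul_at 0 (rotr 1 s))
     = cyclic_sum n.+1 (fun u => cyclic_sum n F (mul_at 0 u)) s.
  rewrite [RHS]cyclic_sumE // [RHS]big_ord_recr /=; congr (_ + _ * _); last 2 first.
  - by apply: eq_sign; rewrite oddM andbb.
  - by rewrite /rotr sn subn1.
  apply: eq_bigr => j _; rewrite mul_at_rot ?sn ?ltnS ?leq_ord //.
  rewrite cyclic_sum_rotr ?sizeM ?size_rot // ?(ltnW (ltn_ord j)) //.
  by rewrite mulrA -exprD mulnS.
transitivity (cyclic_sum n.+1 P s
  + \sum_(j < n.+1) (-1) ^+ j.+1 * cyclic_sum n.+1 (F \o mul_at j) s
  + (-1) ^+ n.+2 * cyclic_sum n.+1 (P \o rotr 1) s).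
  have -> : \sum_(j < n.+1) (-1) ^+ j.+1 * cyclic_sum n.+1 (F \o mul_at j) s
      = \sum_(i < n.+2) (-1) ^+ (i.+1 * n.+1)
          * \sum_(j < n.+1) (-1) ^+ j.+1 * F (mul_at j (rot i.+1 s)).
    under eq_bigr do rewrite mulr_sumr.
    rewrite exchange_big; apply: eq_bigr => i _; rewrite mulr_sumr.
    by apply: eq_bigr => j _; exact: mulrCA.
  rewrite mulr_sumr -!big_split /=; apply: eq_bigr => i _.
  by rewrite !mulrDr [in RHS]mulrCA.
(* The two outer faces cancel: removing [rotr 1] costs [(-1)^(n+1)], which together with
   [(-1)^(n+2)] gives -1. *)
rewrite cyclic_sum_comp_rotr cyclic_sum_rotr // mulrA -exprD addrAC.
rewrite (@eq_sign _ _ 1) ?expr1 ?mulN1r ?subrr ?add0r; last first.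
  by rewrite mul1n oddD /=; case: odd.
(* Rotating face [j] to position 0 contributes [(-1)^(j(n+1))], so that the total sign in [j] is
   [-(-1)^(jn)]: summing over [j] then yields the inner cyclic sum. *)
transitivity (\sum_(j < n.+1) - (\sum_(i < n.+2) (-1) ^+ (i.+1 * n.+1) *
     ((-1) ^+ (j * n) * F (rotr j (mul_at 0 (rot i.+1 s)))))).
  apply: eq_bigr => j _; have jn := ltn_ord j.
  rewrite (@eq_cyclic_sum _ _ _ _ ((F \o rotr j \o mul_at 0) \o rot j)); last first.
    by move=> i /=; rewrite mul_at_rot // size_rot sn ltnS.
  rewrite cyclic_sum_comp_rot cyclic_sum_rot // 1?(leqW (ltnW jn)) // mulrA -exprD.
  rewrite mulr_sumr -sumrN; apply: eq_bigr => i _ /=.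
  rewrite mulrCA -mulrN; congr (_ * _); rewrite -mulNr; congr (_ * _).
  rewrite -[RHS]mulN1r -exprS; apply: eq_sign.
  by rewrite /= mulnS !oddD oddM; case: odd; case: odd.
rewrite sumrN exchange_big /=; congr (- _); apply: eq_bigr => i _.
by rewrite -mulr_sumr cyclic_sum_rotrE // sizeM // size_rot.
Qed.

End CyclicBar.

(** * Normalized cochains evaluated on arbitrary words *)

Section Evaluation.

Variables (k : fieldType) (H : finGroupType) (V : vectType k).
Implicit Types (s : seq H).

(** Splits identities between normalized cochains into the words on which cochains are given and the
    words containing 1, where they vanish. *)
Lemma cochain_seq_ind n (P : seq H -> Prop) :
    (forall t : n.-tuple (nontriv H), P (map val t)) ->
    (forall s, size s = n -> 1%g \in s -> P s) ->
  forall s, size s = n -> P s.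
Proof.
move=> Pt P1 s sn; case: (boolP (1%g \in s)) => [/P1|s1]; first exact.
have /all_sigP[t st] : all (fun h : H => h != 1%g) s.
  by apply/allP => h; apply: contraTneq => ->.
have tn : size t == n by rewrite -sn st size_map.
by rewrite st; apply: (Pt (Tuple tn)).
Qed.

Lemma cochain_eval_size n (phi : cochain H V n) s :
  size s != n -> cochain_eval phi s = 0.
Proof. by rewrite /cochain_eval => /negbTE ->. Qed.

Definition eval_at n s (phi : cochain H V n) : V := cochain_eval phi s.

HB.instance Definition _ n s :=
  GRing.isLinear.Build k (cochain H V n) V _ (@eval_at n s)
    (@cochain_eval_is_linear k H V n s).

Lemma cochain_eval0 n s : cochain_eval (0 : cochain H V n) s = 0.
Proof. exact: (linear0 (eval_at s)). Qed.

Lemma cochain_evalN n (phi : cochain H V n) s :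
  cochain_eval (- phi) s = - cochain_eval phi s.
Proof. exact: (linearN (eval_at s)). Qed.

Lemma cochain_evalB n (phi psi : cochain H V n) s :
  cochain_eval (phi - psi) s = cochain_eval phi s - cochain_eval psi s.
Proof. exact: (linearB (eval_at s)). Qed.

Lemma cochain_eqP n (phi psi : cochain H V n) :
  (forall s, size s = n -> cochain_eval phi s = cochain_eval psi s) -> phi = psi.
Proof.
move=> eq_phi; apply/ffunP => t.
by rewrite -!cochain_evalE eq_phi // size_map size_tuple.
Qed.

Lemma mem1_mul_at j i s : (i < size s)%N -> nth 1%g s i = 1%g ->
  (i < j)%N || (j.+1 < i)%N -> 1%g \in mul_at j s.
Proof.
move=> i_s si /orP[ij|ji]; rewrite /mul_at mem_cat inE.
  have := @mem_nth _ 1%g (take j s) i; rewrite nth_take // si => -> //.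
  by rewrite size_take; case: ifP.
have := @mem_nth _ 1%g (drop j.+2 s) (i - j.+2).
rewrite nth_drop subnKC // si => ->; rewrite ?orbT //.
by rewrite size_drop ltn_sub2r // (leq_ltn_trans _ i_s).
Qed.

(* When some entry of s is 1, the two faces that remove it cancel and all the
   other faces contain a 1. *)
Lemma cochain_eval_bar (l r : H -> V -> V) n (phi : cochain H V n) s :
    (forall h, l h 0 = 0) -> (forall h, r h 0 = 0) ->
    l 1%g =1 id -> r 1%g =1 id -> size s = n.+1 ->
  cochain_eval (bar_diff l r phi) s =
    l (head 1%g s) (cochain_eval phi (behead s))
    + \sum_(i < n) (-1) ^+ i.+1 *: cochain_eval phi (mul_at i s)
    + (-1) ^+ n.+1 *: r (last 1%g s) (cochain_eval phi (take n s)).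
Proof.
move=> l0 r0 l1 r1; move: s; apply: cochain_seq_ind => [t|s sn s1].
  by rewrite cochain_evalE ffunE.
rewrite cochain_eval_eq0 //.
(* [E] lists all [n + 2] faces in order, the outer ones being [E 0] and [E n.+1], so that the
   cancelling pair [E j], [E j.+1] is treated uniformly. *)
pose E i := if i is i'.+1 then
    if i' == n then r (last 1%g s) (cochain_eval phi (take n s))
    else cochain_eval phi (mul_at i' s)
  else l (head 1%g s) (cochain_eval phi (behead s)).
transitivity (\sum_(i < n.+2) (-1) ^+ i *: E i); last first.
  rewrite big_ord_recr big_ord_recl /= eqxx scale1r; congr (_ + _ + _).
  by apply: eq_bigr => i _; rewrite /= /bump /= add1n add0n ltn_eqF.
have [j jn sj] : exists2 j, (j < n.+1)%N & nth 1%g s j = 1%g.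
  by exists (index 1%g s); rewrite ?nth_index // -sn index_mem.
have js : (j < size s)%N by rewrite sn.
have Ej : E j = E j.+1.
  have s_j : s = take j s ++ 1%g :: drop j.+1 s.
    by rewrite -sj -drop_nth // cat_take_drop.
  have -> : E j = cochain_eval phi (take j s ++ drop j.+1 s).
    case: j jn sj js s_j => [|j] /= jn sj js s_j.
      by rewrite -[head _ _]nth0 sj l1 take0 -drop1.
    rewrite ltn_eqF // /mul_at sj mulg1 -cat_rcons -take_nth //.
    exact: ltnW.
  rewrite /E; case: eqP => [jn'|/eqP jn'].
    have -> : last 1%g s = 1%g by rewrite -nth_last sn /= -[in LHS]jn' sj.
    have -> : take n s = take j s by rewrite jn'.
    by rewrite r1 drop_oversize ?cats0 // sn jn'.
  rewrite /mul_at sj mul1g -drop_nth // sn ltnS ltn_neqAle jn' -ltnS //.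
have E0 i : i != j -> i != j.+1 -> (i < n.+2)%N -> E i = 0.
  case: i => [|i] ij ij1 i_n /=.
    rewrite cochain_eval_eq0 //; case: (j) ij js sj => // j' _ js sj.
    by rewrite -sj -nth_behead mem_nth // size_behead -ltnS prednK // sn.
  case: eqP => [i_eq|_].
    have jn' : (j < n)%N by rewrite ltn_neqAle -ltnS jn andbT eq_sym -i_eq -eqSS.
    rewrite cochain_eval_eq0 //; have := @mem_nth _ 1%g (take n s) j.
    by rewrite nth_take // sj size_take sn ltnSn => ->.
  rewrite cochain_eval_eq0 //; apply: (mem1_mul_at js sj).
  by move: ij ij1; lia.
have j1n : (j.+1 < n.+2)%N by [].
rewrite (bigD1 (Ordinal (ltnW j1n))) //= (bigD1 (Ordinal j1n)) /=; last first.
  by rewrite -val_eqE /= gtn_eqF.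
rewrite Ej big1 => [|i]; last first.
  rewrite -!val_eqE /= => /andP[ij ij1]; rewrite E0 ?scaler0 //.
by rewrite addr0 exprS mulN1r scaleNr subrr.
Qed.

End Evaluation.

(** * The Batalin-Vilkovisky operator and the Hochschild differential *)

Section HochschildBV.

Variables (k : fieldType) (G : finGroupType).
Local Notation kG := (group_alg k G).
Local Notation C n := (cochain G kG n).
Implicit Types (g h y z : G) (s : seq G) (a b : kG).

Lemma gmul_geltl g a h : gmul (gelt k g) a h = a (g^-1 * h)%g.
Proof.
rewrite ffunE (bigD1 g) //= ffunE eqxx mul1r big1 ?addr0 // => g' /negbTE gg'.
by rewrite ffunE gg' mul0r.
Qed.

Lemma gmul_geltr a g h : gmul a (gelt k g) h = a (h * g^-1)%g.
Proof.
rewrite ffunE (bigD1 (h * g^-1)%g) //= ffunE invMg invgK mulgKV eqxx mulr1.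
rewrite big1 ?addr0 // => g' /negbTE gg'; rewrite ffunE.
case: eqP => [E|]; last by rewrite mulr0.
by rewrite -E invMg invgK mulKVg eqxx in gg'.
Qed.

Lemma gform_gelt1 a : gform a (gelt k 1%g) = a 1%g.
Proof.
rewrite /gform (bigD1 1%g) //= (bigD1 1%g) //= ffunE invg1 !eqxx !mulr1.
rewrite big1 ?addr0 => [|h /negbTE h1]; last by rewrite ffunE h1 mulr0 mul0r.
rewrite big1 ?addr0 // => g /negbTE g1; rewrite big1 // => h _; rewrite ffunE.
case: eqP => [->|]; last by rewrite mulr0 mul0r.
by rewrite invg1 g1 mulr0.
Qed.

Lemma hoch_diff_eval n (phi : C n) s z : size s = n.+1 ->
  cochain_eval (hoch_diff k G n phi) s z =
    cochain_eval phi (behead s) ((head 1 s)^-1 * z)%g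
    + \sum_(i < n) (-1) ^+ i.+1 * cochain_eval phi (mul_at i s) z
    + (-1) ^+ n.+1 * cochain_eval phi (take n s) (z * (last 1 s)^-1)%g.
Proof.
move=> sn; rewrite lfunE /= cochain_eval_bar //.
- have addE a b : (a + b) z = a z + b z by rewrite ffunE.
  have scaleE c a : (c *: a) z = c * a z by rewrite ffunE.
  rewrite !addE scaleE gmul_geltl /gmulr gmul_geltr sum_ffunE.
  by congr (_ + _ + _); apply: eq_bigr => i _; rewrite ffunE.
- by move=> h; apply: linear0.
- by move=> h; apply: linear0.
- by move=> a; apply/ffunP => h; rewrite gmul_geltl invg1 mul1g.
- by move=> a; apply/ffunP => h; rewrite /gmulr gmul_geltr invg1 mulg1.
Qed.

(** The coefficient at [y] retains only the summand [g = y^-1], pairing with 1 reads the coefficient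
    at 1, and the words fed to [phi] are the rotations of [y^-1 :: s]. If [s] contains 1, both sides
    vanish. *)
Lemma BV_eval n (phi : C n.+1) s y : size s = n ->
  cochain_eval (BV phi) s y =
    cyclic_sum n (fun u => cochain_eval phi u 1%g) (y^-1%g :: s).
Proof.
move: s; apply: cochain_seq_ind => [t|s sn s1].
  rewrite cochain_evalE ffunE sum_ffunE (bigD1 y^-1%g) //= invgK sum_ffunE.
  rewrite [X in _ + X]big1 ?addr0 => [|g gy].
    by apply: eq_bigr => i _; rewrite !ffunE eqxx gform_gelt1 [_ *: _]mulr1.
  rewrite sum_ffunE big1 // => i _; rewrite !ffunE -eq_invg_sym.
  by rewrite eq_sym (negbTE gy) scaler0.
rewrite cochain_eval_eq0 // ffunE /cyclic_sum big1 // => i _.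
by rewrite cochain_eval_eq0 ?ffunE ?mulr0 // mem_rot inE s1 orbT.
Qed.

Lemma BV_diff n (phi : C n.+1) :
  hoch_diff k G n (BV phi) = - BV (hoch_diff k G n.+1 phi).
Proof.
apply: cochain_eqP => s sn; apply/ffunP => y.
(* [P] is the first face read at the coefficient of 1. This coefficient is a trace, so the last face
   is [P] after [rotr 1]. *)
pose P u := cochain_eval phi (behead u) (head 1%g u)^-1%g.
rewrite cochain_evalN ffunE /=.
rewrite BV_eval // hoch_diff_eval //.
rewrite (@eq_cyclic_sum _ _ _ _ (fun u => P u
      + \sum_(i < n.+1) (-1) ^+ i.+1 * cochain_eval phi (mul_at i u) 1%g
      + (-1) ^+ n.+2 * P (rotr 1 u))); last first.
  move=> i; rewrite hoch_diff_eval ?size_rot //= ?sn // mulg1 mul1g.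
  congr (_ + _ * _); rewrite /P; set u := rot i _.
  have un : size u = n.+2 by rewrite size_rot /= sn.
  by case/lastP: u un => // u c; rewrite size_rcons => -[un];
     rewrite rotr1_rcons last_rcons -cats1 take_size_cat.
rewrite (@cyclic_sum_bar _ _ n (fun u => cochain_eval phi u 1%g) P) /= ?sn //.
(* The outer faces on the left are the ones that merge [y^-1] with the first and with the last entry
   of [s]. *)
rewrite opprK big_ord_recl BV_eval ?size_behead ?sn //; congr (_ + _ + _).
- by case: s sn => // h s _; rewrite mul1r invMg invgK /mul_at /= drop0.
- apply: eq_bigr => i _; rewrite BV_eval ?size_mul_at ?sn ?ltnS //.
- rewrite BV_eval ?size_take ?sn ?ltnSn // invMg invgK.
  case/lastP: s sn => // s h; rewrite size_rcons => -[sn].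
  by rewrite -rcons_cons rotr1_rcons last_rcons -cats1 take_size_cat // /mul_at /= drop0.
Qed.

(** The degree 0 case of anticommutation: the coefficients of [g a] and [a g] at 1 agree. *)
Lemma BV_diff0 (phi : C 0) : BV (hoch_diff k G 0 phi) = 0.
Proof.
apply: cochain_eqP => s sn; apply/ffunP => y.
rewrite BV_eval // (size0nil sn) /cyclic_sum big_ord_recl big_ord0 /= cochain_eval0.
rewrite hoch_diff_eval //= big_ord0 ffunE invgK mulg1 mul1g.
by rewrite !addr0 mulN1r subrr mulr0.
Qed.

End HochschildBV.

(** * Conjugacy class summands and restriction to the centralizer *)

Section Centralizer.

Variables (k : fieldType) (G : finGroupType) (x : G).
Local Notation kG := (group_alg k G).
Local Notation C n := (cochain G kG n).
Local Notation Cx := (centr x).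
Local Notation class_x := (x ^: [set: G])%g.
Implicit Types (g h p y z : G) (s : seq G) (t : seq Cx).

Lemma class_xJ h y : (y ^ h \in class_x)%g = (y \in class_x).
Proof.
have clJ u v : (u \in class_x -> u ^ v \in class_x)%g.
  by case/imsetP => w _ ->; rewrite -conjgM imset_f ?in_setT //.
by apply/idP/idP => [/(clJ _ h^-1%g)|/clJ//]; rewrite conjgK.
Qed.

(** The spanning vectors are basis elements of the group algebra, so membership is a condition on
    the support. *)
Lemma mem_coset_span p (a : kG) :
  reflect (forall z, a z != 0 -> (p^-1 * z \in class_x)%g) (a \in coset_span k x p).
Proof.
apply: (iffP idP) => [a_x z|a_x].
  apply: contraNT => pz; move: a_x; rewrite /coset_span; set X := image _ _ => a_x.
  rewrite (coord_span (X := in_tuple X) a_x) sum_ffunE big1 // => i _.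
  have /imageP[c c_x ->] : (in_tuple X)`_i \in X by rewrite mem_nth.
  rewrite !ffunE; case: eqP => [zE|_]; last by rewrite scaler0.
  by rewrite zE mulKg c_x in pz.
have -> : a = \sum_(z : G) a z *: gelt k z.
  apply/ffunP => h; rewrite sum_ffunE (bigD1 h) //= big1 => [|z zh].
    by rewrite !ffunE eqxx addr0 [_ *: _]mulr1.
  by rewrite !ffunE eq_sym (negbTE zh) scaler0.
apply: memv_suml => z _; have [->|az] := eqVneq (a z) 0.
  by rewrite scale0r mem0v.
apply/memvZ/memv_span/imageP; exists (p^-1 * z)%g; first exact: a_x.
by rewrite mulKVg.
Qed.

Lemma Hx_eval n (phi : C n) s z : phi \in Hx k x n ->
  cochain_eval phi s z != 0 -> ((\prod_(g <- s) g)^-1 * z \in class_x)%g.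
Proof.
move=> /memHx phi_x; have [sn|sn] := eqVneq (size s) n; last first.
  by rewrite cochain_eval_size // ffunE eqxx.
move: s sn; apply: cochain_seq_ind => [t|s sn s1].
  by rewrite cochain_evalE big_map; apply/mem_coset_span.
by rewrite cochain_eval_eq0 // ffunE eqxx.
Qed.

Lemma prod_rot i s :
  (\prod_(g <- rot i s) g = (\prod_(g <- s) g) ^ (\prod_(g <- take i s) g))%g.
Proof.
by rewrite -[in RHS](cat_take_drop i s) !big_cat cat_take_drop conjgE -mulgA mulKg.
Qed.

(** A nonzero coefficient at [z] needs a rotation of [z^-1 :: t] with nonzero value at 1. The
    inverse of its product is then in the class, and rotating only conjugates the product. *)
Lemma BV_Hx n (phi : C n.+1) : phi \in Hx k x n.+1 -> BV phi \in Hx k x n.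
Proof.
move=> phi_x; apply/memHx => t; apply/mem_coset_span => z.
rewrite -cochain_evalE BV_eval ?size_map ?size_tuple // => sum_neq0.
have [i|no_i] := pickP (fun i : 'I_n.+1 =>
    cochain_eval phi (rot i.+1 (z^-1 :: map val t)%g) 1%g != 0); last first.
  case/eqP: sum_neq0; apply: big1 => i _.
  by have /negbFE/eqP-> := no_i i; rewrite mulr0.
move/(Hx_eval phi_x); rewrite mulg1 prod_rot -conjVg class_xJ big_cons.
by rewrite invMg invgK big_map.
Qed.

Lemma prod_rev_inv (H : finGroupType) (s : seq H) :
  (\prod_(h <- rev s) h^-1 = (\prod_(h <- s) h)^-1)%g.
Proof.
elim: s => [|h s IH]; first by rewrite !big_nil invg1.
by rewrite rev_cons -cats1 big_cat big_seq1 IH big_cons invMg.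
Qed.

Lemma prod_mul_at (H : finGroupType) i (s : seq H) : (i.+1 < size s)%N ->
  (\prod_(h <- mul_at i s) h = \prod_(h <- s) h)%g.
Proof.
move=> i_s; have {2}-> : s = take i s ++ [:: nth 1 s i, nth 1 s i.+1 & drop i.+2 s]%g.
  by rewrite -!drop_nth ?cat_take_drop // ltnW.
by rewrite !big_cat !big_cons /= -!mulgA.
Qed.

Lemma sgval_centr (h : Cx) : (sgval h \in 'C[x])%g.
Proof. exact: subgP. Qed.

Lemma prod_sgval t : (sgval (\prod_(h <- t) h) = \prod_(h <- map sgval t) h)%g.
Proof. by rewrite big_map; elim/big_rec2: _ => // h y z _ <-. Qed.

Lemma prod_centr t : (\prod_(h <- map sgval t) h \in 'C[x])%g.
Proof. by rewrite -prod_sgval sgval_centr. Qed.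

Lemma map_sgval_mul_at i t : (i.+1 < size t)%N ->
  map sgval (mul_at i t) = mul_at i (map sgval t).
Proof.
move=> it; rewrite /mul_at map_cat map_take /= map_drop.
by rewrite !(nth_map 1%g) // ltnW.
Qed.

Lemma group_diff_eval (H : finGroupType) n (psi : cochain H k^o n) (s : seq H) :
    size s = n.+1 ->
  cochain_eval (group_diff k H n psi) s =
    cochain_eval psi (behead s)
    + \sum_(i < n) (-1) ^+ i.+1 * cochain_eval psi (mul_at i s)
    + (-1) ^+ n.+1 * cochain_eval psi (take n s).
Proof. by move=> sn; rewrite lfunE /= cochain_eval_bar. Qed.

Lemma centr_res_eval n (phi : C n) t :
  cochain_eval (centr_res x phi) t =
    cochain_eval phi (map sgval t) (x * \prod_(h <- map sgval t) h)%g.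
Proof.
have [tn|tn] := eqVneq (size t) n; last first.
  by rewrite !cochain_eval_size ?size_map // ffunE.
move: t tn; apply: cochain_seq_ind => [t|t tn t1].
  rewrite cochain_evalE ffunE /= gmul_geltr prod_rev_inv invgK -map_comp.
  by [].
rewrite !cochain_eval_eq0 ?ffunE //.
by apply/mapP; exists 1%g.
Qed.

Lemma centr_res_is_linear n : linear (@centr_res k G x n).
Proof.
move=> a u v; apply: cochain_eqP => t _.
by rewrite cochain_eval_is_linear !centr_res_eval cochain_eval_is_linear !ffunE.
Qed.

HB.instance Definition _ n :=
  GRing.isLinear.Build k (C n) (cochain Cx k^o n) _ (@centr_res k G x n)
    (@centr_res_is_linear n).

Lemma centr_res_diff n (phi : C n) :
  group_diff k Cx n (centr_res x phi) = centr_res x (hoch_diff k G n phi).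
Proof.
apply: cochain_eqP => t tn; rewrite group_diff_eval // [RHS]centr_res_eval.
rewrite hoch_diff_eval ?size_map // !centr_res_eval; congr (_ + _ + _ * _).
(* The leading entry centralizes [x], so it moves past [x] and cancels. *)
- case: t tn => // h t _ /=; rewrite big_cons (mulgA x).
  by have /cent1P <- := sgval_centr h; rewrite -mulgA mulKg.
- apply: eq_bigr => i _; rewrite centr_res_eval map_sgval_mul_at ?tn ?ltnS //.
  by rewrite prod_mul_at // size_map tn ltnS.
- case/lastP: t tn => // t h; rewrite size_rcons => -[tn].
  rewrite map_rcons last_rcons -!cats1 !take_size_cat ?size_map // big_cat.
  by rewrite big_seq1 mulgA mulgK.
Qed.

Lemma centr_res_BV n (phi : C n.+1) :
  centr_res x (BV phi) = BVhat_formula (centr_res x phi) :> cochain Cx k^o n.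
Proof.
apply/ffunP => t; rewrite -cochain_evalE centr_res_eval.
rewrite BV_eval ?size_map ?size_tuple // ffunE; apply: eq_bigr => i _.
rewrite centr_res_eval; set s := map val t.
set g : Cx := (_ * (subg _ x)^-1)%g; set p := (\prod_(h <- map sgval s) h)%g.
(* The entry inserted by the formula is the inverse of the element [x p] at which the coefficient is
   taken, hence the head of the word in [BV_eval]. *)
have gE : sgval g = ((x * p)^-1)%g.
  rewrite [LHS]/(sgval _ * (sgval (subg 'C[x]%G x))^-1)%g subgK ?cent1id //.
  by rewrite prod_rev_inv [sgval _]/((sgval _)^-1)%g prod_sgval invMg.
rewrite -[_ ++ _]/(rot i.+1 (g :: s)) map_rot map_cons gE; congr (_ * _).
congr (cochain_eval phi _ _); rewrite prod_rot.
(* The word has product [x^-1]; its prefixes centralize [x], so every rotation has the same product,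
   and [centr_res] reads the coefficient at [x x^-1 = 1]. *)
have -> : (\prod_(h <- (x * p)^-1 :: map sgval s) h = x^-1)%g.
  have /cent1P xp := prod_centr s.
  by rewrite big_cons -xp invMg mulgKV.
have -> : (x * p)^-1%g :: map sgval s = map sgval (g :: s) by rewrite -gE.
rewrite -map_take conjVg.
have /cent1P xp := prod_centr (take i.+1 (g :: s)).
by rewrite conjgE -xp mulKg mulgV.
Qed.

(** * A section of the restriction, built from chosen conjugators *)

(** The value 1 at [x] makes straightening from [x] the identity on words of the centralizer;
    elsewhere the choice is arbitrary. *)
Definition conjugator y : G :=
  if y == x then 1%g else repr [set g | (x ^ g == y)%g].

Lemma conjugatorP y : y \in class_x -> (x ^ conjugator y = y)%g.
Proof.
rewrite /conjugator; case: eqP => [->|_ /imsetP[g _ yE]]; first by rewrite conjg1.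
apply/eqP; suff: repr [set g | x ^ g == y]%g \in [set g | x ^ g == y]%g by rewrite inE.
  by apply: (mem_repr g); rewrite inE yE.
Qed.

(* The path y, y^g1, y^(g1 g2), ... in the conjugacy class of x is closed up
   at x by the chosen conjugators. *)
Fixpoint straighten y s : seq Cx :=
  if s is g :: s' then
    subg _ (conjugator y * g * (conjugator (y ^ g))^-1)%g :: straighten (y ^ g)%g s'
  else [::].

Lemma size_straighten y s : size (straighten y s) = size s.
Proof. by elim: s y => //= g s IH y; rewrite IH. Qed.

Lemma straighten_mem1 y s : 1%g \in s -> 1%g \in straighten y s.
Proof.
elim: s y => //= g s IH y; rewrite !inE => /orP[/eqP<-|/IH->]; last by rewrite orbT.
rewrite conjg1 mulg1 mulgV; apply/orP; left; apply/eqP/val_inj.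
by rewrite subgK ?group1.
Qed.

Lemma take_straighten i y s : take i (straighten y s) = straighten y (take i s).
Proof. by elim: s i y => [|g s IH] [|i] y //=; rewrite IH. Qed.

(** Conjugation by the three factors takes [x] to [y], then to [y ^ g], then back to [x]. *)
Lemma straighten_elt y g : y \in class_x ->
  (conjugator y * g * (conjugator (y ^ g))^-1 \in 'C[x])%g.
Proof.
move=> y_x; apply/cent1P/commute_sym/commgP/conjg_fixP; rewrite !conjgM conjugatorP //.
by rewrite -{1}(@conjugatorP (y ^ g)%g) ?conjgK // class_xJ.
Qed.

(** The conjugator of the intermediate point cancels between two neighbouring entries. *)
Lemma straighten_mul_at i y s : y \in class_x -> (i.+1 < size s)%N ->
  straighten y (mul_at i s) = mul_at i (straighten y s).
Proof.
elim: s i y => [|g s IH] [|i] y //= y_x.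
  case: s {IH} => //= h s _; rewrite /mul_at /= !drop0 conjgM; congr (_ :: _).
  apply: val_inj; rewrite /= !subgK ?straighten_elt ?class_xJ // -?conjgM ?straighten_elt //.
  by rewrite !mulgA mulgKV.
by move=> i_s; rewrite -[RHS]/(_ :: mul_at i _) -IH ?class_xJ.
Qed.

Lemma straighten_sgval t : straighten x (map sgval t) = t.
Proof.
elim: t => //= h t; have /cent1P/commute_sym/commgP/conjg_fixP-> := sgval_centr h.
by move=> ->; rewrite /conjugator eqxx mul1g invg1 mulg1 sgvalK.
Qed.

(** Writing [z = y g_1 ... g_n] with the class element [y] on the left matches [centr_res], which
    reads the case [y = x]. *)
Definition centr_ext n (psi : cochain Cx k^o n) : C n :=
  [ffun t : n.-tuple (nontriv G) => let s := map val t in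
     [ffun z => let y := (z * (\prod_(g <- s) g)^-1)%g in
        if y \in class_x then cochain_eval psi (straighten y s) else 0]].

Lemma centr_ext_eval n (psi : cochain Cx k^o n) s z :
  let y := (z * (\prod_(g <- s) g)^-1)%g in
  cochain_eval (centr_ext psi) s z =
    if y \in class_x then cochain_eval psi (straighten y s) else 0.
Proof.
move=> y; rewrite {}/y; have [sn|sn] := eqVneq (size s) n; last first.
  by rewrite !cochain_eval_size ?size_straighten // ffunE if_same.
move: s sn; apply: cochain_seq_ind => [t|s sn s1].
  by rewrite cochain_evalE !ffunE.
by rewrite !cochain_eval_eq0 ?straighten_mem1 // ffunE if_same.
Qed.

Lemma centr_ext_Hx n (psi : cochain Cx k^o n) : centr_ext psi \in Hx k x n.
Proof.
apply/memHx => t; apply/mem_coset_span => z.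
rewrite -cochain_evalE centr_ext_eval big_map.
case: ifP => [|_]; last by rewrite eqxx.
by rewrite -(class_xJ (\prod_(g <- t) val g)%g) conjgE mulgKV.
Qed.

Lemma centr_extK n (psi : cochain Cx k^o n) : centr_res x (centr_ext psi) = psi.
Proof.
apply: cochain_eqP => t tn; rewrite centr_res_eval centr_ext_eval mulgK.
by rewrite class_refl straighten_sgval.
Qed.

Lemma centr_ext0 n : centr_ext (0 : cochain Cx k^o n) = 0.
Proof.
apply: cochain_eqP => s _; apply/ffunP => z.
by rewrite centr_ext_eval !cochain_eval0 if_same ffunE.
Qed.

(** The first face drops [g_1] and moves the base point from [y] to [y ^ g_1]; all other faces keep
    [y]. Straightening thus commutes with faces, and outside the class all terms vanish. *)
Lemma centr_ext_diff n (psi : cochain Cx k^o n) :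
  hoch_diff k G n (centr_ext psi) = centr_ext (group_diff k Cx n psi).
Proof.
apply: cochain_eqP => s sn; apply/ffunP => z.
rewrite hoch_diff_eval // [RHS]centr_ext_eval !centr_ext_eval.
set y := (z * (\prod_(g <- s) g)^-1)%g.
have -> : ((head 1 s)^-1 * z * (\prod_(g <- behead s) g)^-1 = y ^ (head 1 s))%g.
  case: s sn @y => // g s _ y; rewrite /y big_cons conjgE invMg /= !mulgA.
  by rewrite mulgKV.
have -> : (z * (last 1 s)^-1 * (\prod_(g <- take n s) g)^-1 = y)%g.
  case/lastP: s sn @y => // s g; rewrite size_rcons => -[sn] y.
  by rewrite /y last_rcons -cats1 take_size_cat // big_cat big_seq1 /= invMg mulgA.
under eq_bigr => i _ do rewrite centr_ext_eval prod_mul_at ?sn ?ltnS // -/y.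
rewrite class_xJ; case: ifP => y_x; last first.
  by rewrite mulr0 big1 ?addr0 // => i _; rewrite mulr0.
rewrite group_diff_eval ?size_straighten // take_straighten; congr (_ + _ + _).
  by case: s sn {y_x} @y.
by apply: eq_bigr => i _; rewrite straighten_mul_at ?sn ?ltnS.
Qed.

(** * The formula on cocycles and coboundaries, and the induced maps *)

Lemma BVhat_formulaB n (psi psi' : cochain Cx k^o n.+1) :
  BVhat_formula (psi - psi') = BVhat_formula psi - BVhat_formula psi'.
Proof.
apply/ffunP => t; rewrite !ffunE -sumrB; apply: eq_bigr => i _.
by rewrite cochain_evalB mulrBr.
Qed.

Lemma BVhat_formula0 n : BVhat_formula (0 : cochain Cx k^o n.+1) = 0.
Proof. by rewrite -(subrr 0) BVhat_formulaB subrr. Qed.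

Lemma BVhat_formula_diff n (psi : cochain Cx k^o n.+1) :
  group_diff k Cx n (BVhat_formula psi) = - BVhat_formula (group_diff k Cx n.+1 psi).
Proof.
rewrite -[in LHS](centr_extK psi) -centr_res_BV centr_res_diff BV_diff raddfN.
by rewrite /= centr_res_BV centr_ext_diff centr_extK.
Qed.

Lemma BVhat_formula_diff0 (psi : cochain Cx k^o 0) :
  BVhat_formula (group_diff k Cx 0 psi) = 0.
Proof.
by rewrite -(centr_extK psi) centr_res_diff -centr_res_BV BV_diff0 raddf0.
Qed.

Lemma group_cocyclesP n (psi : cochain Cx k^o n) :
  reflect (group_diff k Cx n psi = 0) (psi \in group_cocycles k Cx n).
Proof. by rewrite memv_cap memvf memv_ker; apply: eqP. Qed.

Lemma BVhat_formula_cocycle n (psi : cochain Cx k^o n.+1) :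
  psi \in group_cocycles k Cx n.+1 -> BVhat_formula psi \in group_cocycles k Cx n.
Proof.
move=> /group_cocyclesP psi_Z; apply/group_cocyclesP.
by rewrite BVhat_formula_diff psi_Z BVhat_formula0 oppr0.
Qed.

Lemma BVhat_formula_coboundary n (psi : cochain Cx k^o n.+1) :
  psi \in coboundaries (group_diff k Cx) (fun=> fullv) n.+1 ->
  BVhat_formula psi \in coboundaries (group_diff k Cx) (fun=> fullv) n.
Proof.
(* In target degree 0 the only coboundary is 0, so the formula has to vanish there. *)
case/memv_imgP => theta _ ->{psi}; case: n theta => [|n] theta.
  by rewrite BVhat_formula_diff0 mem0v.
rewrite -[BVhat_formula _]opprK -BVhat_formula_diff rpredN.
by rewrite memv_img ?memvf.
Qed.

Lemma BV_cocycle n (phi : C n.+1) :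
  phi \in cocycles (hoch_diff k G) (Hx k x) n.+1 ->
  BV phi \in cocycles (hoch_diff k G) (Hx k x) n.
Proof.
rewrite !memv_cap !memv_ker => /andP[phi_x /eqP phi_Z]; rewrite BV_Hx //=.
rewrite BV_diff phi_Z; apply/eqP/oppr_inj; rewrite opprK oppr0.
apply: cochain_eqP => s sn; apply/ffunP => y; rewrite BV_eval // cochain_eval0.
by rewrite ffunE /cyclic_sum big1 // => i _; rewrite cochain_eval0 ffunE mulr0.
Qed.

Lemma centr_res_cocycle n (phi : C n) :
  phi \in cocycles (hoch_diff k G) (Hx k x) n ->
  centr_res x phi \in group_cocycles k Cx n.
Proof.
rewrite memv_cap memv_ker => /andP[_ /eqP phi_Z]; apply/group_cocyclesP.
by rewrite centr_res_diff phi_Z raddf0.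
Qed.

(** Frees [centr_iso] from the chosen representative: restriction preserves cocycles and
    coboundaries. *)
Lemma centr_isoE n (phi : C n) :
  phi \in cocycles (hoch_diff k G) (Hx k x) n ->
  centr_iso (coh_class (hoch_diff k G) (Hx k x) phi) =
    group_class (centr_res x phi).
Proof.
apply: (coh_mapE (f := @centr_res k G x n)) => v; first exact: centr_res_cocycle.
case: n phi v => [|n] phi v; first by rewrite !memv0 => /eqP->; rewrite raddf0.
by case/memv_imgP => u _ ->; rewrite /= -centr_res_diff memv_img ?memvf.
Qed.

End Centralizer.

Theorem theorem8p2 (k : fieldType) (G : finGroupType) (x : G) (n : nat)
    (psi : cochain (centr x) k^o n.+1)
    (hpsi : psi \in group_cocycles k (centr x) n.+1) :
  BVhat_formula psi \in group_cocycles k (centr x) n /\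
  BVhat (group_class psi) = group_class (BVhat_formula psi).
Proof.
split; first exact: BVhat_formula_cocycle.
rewrite /BVhat /=; set c := functions.pinv_ _ _ _ _.
(* [pinv] inverts [centr_iso] at any class in its image, and the extension of [psi] is a cocycle
   whose class maps to that of [psi]. *)
have c_psi : centr_iso c = group_class psi.
  apply: functions.pinvK; apply/classical_sets.mem_set.
  exists (coh_class (hoch_diff k G) (Hx k x) (centr_ext psi)) => //.
  rewrite centr_isoE ?centr_extK // memv_cap centr_ext_Hx memv_ker.
  by rewrite centr_ext_diff (group_cocyclesP _ hpsi) centr_ext0 eqxx.
rewrite /BVx /coh_map; set phi := coh_rep c.
have phi_Z : phi \in cocycles (hoch_diff k G) (Hx k x) n.+1 by exact: coh_repP.
rewrite centr_isoE ?BV_cocycle // centr_res_BV.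
apply/coh_classP; rewrite ?BVhat_formula_cocycle ?centr_res_cocycle //.
(* It remains that [psi] and the restriction of [phi] are cohomologous, which is [c_psi] with
   [coh_map] unfolded. *)
rewrite -BVhat_formulaB; apply: BVhat_formula_coboundary.
apply/coh_classP => //; first exact: centr_res_cocycle.
Qed.
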